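(* Let $L\ge 0$, let $N$ be an odd positive integer with $2L+1\le N$, let $\lambda>0$, and let $f\in C(\mathbb{S}^1)$. Let $\mathbf f=[f(x_1),\dots,f(x_N)]^T$. Then the optimal solution $\boldsymbol\alpha=(\alpha_{0,1},\alpha_{1,1},\alpha_{1,2},\dots,\alpha_{L,1},\alpha_{L,2})^T$ of $$\min_{\boldsymbol\alpha\in\mathbb{R}^{2L+1}}\ \|\mathbf W^{1/2}(\mathbf A\boldsymbol\alpha-\mathbf f)\|_2^2+\lambda\|\mathbf W^{1/2}\mathbf R_L^T\boldsymbol\alpha\|_2^2$$ is given by $$\alpha_{\ell,k}=\frac{\langle f,Y_{\ell,k}\rangle_N}{1+\lambda\beta_{\ell,k}^2}$$ for all index pairs $(\ell,k)$ with $0\le\ell\le L$, $1\le k\le \gamma_\ell+1$. Consequently, the minimizer of $$\min_{p\in\mathbb{P}_L}\left\{\sum_{j=1}^N\frac{2\pi}{N}\big(p(x_j)-f(x_j)\big)^2+\lambda\sum_{j=1}^N\frac{2\pi}{N}\big(\mathcal R_Lp(x_j)\big)^2\right\}$$ is $$p^{\beta}_{\lambda,L,N}(x)=\sum_{\ell=0}^L\sum_{k=1}^{\gamma_\ell+1}\frac{\langle f,Y_{\ell,k}\rangle_N}{1+\lambda\beta_{\ell,k}^2}\,Y_{\ell,k}(x).$$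
   Context: Points $x=(\cos\theta,\sin\theta)^T$ of the unit circle $\mathbb{S}^1$ are identified with angles $\theta\in[-\pi,\pi]$ (mod $2\pi$); $C(\mathbb{S}^1)$ is the space of real continuous functions on $\mathbb{S}^1$. Put $Y_{0,1}=1/\sqrt{2\pi}$, $Y_{\ell,1}(x)=\cos(\ell\theta)/\sqrt\pi$, $Y_{\ell,2}(x)=\sin(\ell\theta)/\sqrt\pi$ for $\ell\ge1$; $\gamma_0=0$ and $\gamma_\ell=1$ for $\ell\ge1$. $\mathbb{P}_L$ is the span of $Y_{\ell,k}$, $0\le\ell\le L$, $1\le k\le\gamma_\ell+1$ (dimension $2L+1$). The points $x_1,\dots,x_N\in\mathbb{S}^1$ are equidistant with consecutive angles differing by $2\pi/N$; they form the nodes of the trapezoidal rule, which satisfies $\int_{-\pi}^{\pi}p\,dx=\frac{2\pi}{N}\sum_{j=1}^Np(x_j)$ for all $p\in\mathbb{P}_{N-1}$. The discrete inner product is $\langle v,z\rangle_N=\frac{2\pi}{N}\sum_{j=1}^Nv(x_j)z(x_j)$. The numbers $\beta_{0,1},\beta_{1,1},\beta_{1,2},\dots,\beta_{L,1},\beta_{L,2}$ form a nondecreasing sequence of nonnegative reals, and $\mathcal R_L:\mathbb{P}_L\to\mathbb{P}_L$ is the linear operator with $\mathcal R_LY_{\ell,k}=\beta_{\ell,k}Y_{\ell,k}$. $\mathbf A\in\mathbb{R}^{N\times(2L+1)}$ is the matrix whose $j$-th row is $(Y_{0,1}(x_j),Y_{1,1}(x_j),Y_{1,2}(x_j),\dots,Y_{L,1}(x_j),Y_{L,2}(x_j))$;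 $\mathbf W=\frac{2\pi}{N}\mathbf I_N$; $\mathbf B_L=\mathrm{diag}(\beta_{0,1},\beta_{1,1},\beta_{1,2},\dots,\beta_{L,1},\beta_{L,2})$; $\mathbf R_L=\mathbf B_L\mathbf A^T$. *)

(* Defs.v *)
(* Points of the unit circle are represented by real angles modulo 2 pi, and
   functions on the circle by 2 pi-periodic functions of the angle. *)
From mathcomp Require Import all_boot all_order all_algebra.
From mathcomp Require Import all_classical all_reals all_analysis.
From mathcomp Require Import zify.

Set Implicit Arguments.
Unset Strict Implicit.
Unset Printing Implicit Defensive.

Import Order.TTheory GRing.Theory Num.Theory.
Import numFieldNormedType.Exports.

Local Open Scope classical_set_scope.
Local Open Scope ring_scope.

Definition is_minimizer {R : realType} {T : Type} (D : set T) (obj : T -> R)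
    (x : T) : Prop :=
  D x /\ forall y, D y -> obj x <= obj y.

Definition gamma (l : nat) : nat := (0 < l)%N.

Definition valid_pair (L l k : nat) : Prop :=
  (l <= L)%N /\ (1 <= k <= gamma l + 1)%N.

(* Vectors indexed by (0,1), (1,1), (1,2), ..., (L,1), (L,2) are vectors over
   'I_(L.*2.+1): [pos l k] is the position of (l,k) in this list, and
   (deg i, ord i) is the pair at position i. *)
Definition pos (l k : nat) : nat := if l is 0 then 0 else (l.*2 + k - 2)%N.
Definition deg (i : nat) : nat := uphalf i.
Definition ord (i : nat) : nat := if (0 < i)%N && ~~ odd i then 2 else 1.

Lemma pos_lt L l k : valid_pair L l k -> (pos l k < L.*2.+1)%N.
Proof. by rewrite /valid_pair /pos /gamma; case: l => [|l] /= [] ? ?; lia. Qed.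

Lemma posK L l k : valid_pair L l k -> (deg (pos l k), ord (pos l k)) = (l, k).
Proof.
rewrite /valid_pair /pos /gamma /deg /ord.
case: l => [|l] /= [] _ hk; first by congr pair; lia.
have [->|->] : k = 1%N \/ k = 2%N by lia.
  have -> : (l.+1.*2 + 1 - 2)%N = l.*2.+1 by lia.
  by rewrite /= odd_double /= doubleK.
have -> : (l.+1.*2 + 2 - 2)%N = l.+1.*2 by lia.
by rewrite odd_double uphalf_double.
Qed.

Lemma deg_ordK L i : (i < L.*2.+1)%N ->
  valid_pair L (deg i) (ord i) /\ pos (deg i) (ord i) = i.
Proof.
rewrite /valid_pair /pos /gamma /deg /ord => hi.
have := odd_double_half i; rewrite uphalf_half.
by case: i hi => [|i] //= hi; case: (odd i) => /= h;
  split; [split| |split|]; move: h hi; case: (uphalf i) => [|m] /=; lia.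
Qed.

Section Circle.
Context {R : realType}.
Implicit Types (L N : nat) (beta : nat -> nat -> R) (f p q : R -> R).

(* Only meaningful for 1 <= k <= gamma l + 1. *)
Definition Y (l k : nat) (t : R) : R :=
  if l == 0%N then 1 / Num.sqrt (2 * pi)
  else if k == 1%N then cos (l%:R * t) / Num.sqrt pi
  else sin (l%:R * t) / Num.sqrt pi.

Definition trig_comb L (c : nat -> nat -> R) (t : R) : R :=
  \sum_(0 <= l < L.+1) \sum_(1 <= k < (gamma l + 1).+1) c l k * Y l k t.

Definition trig_poly L : set (R -> R) :=
  [set p | exists c : nat -> nat -> R, p = trig_comb L c].

Definition circle_continuous f : Prop := continuous f /\ periodic f (pi *+ 2).

Definition eq_mod2pi (s t : R) : Prop := exists m : int, s = t + 2 * pi * m%:~R.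

Definition equidistant N (x : 'I_N -> R) : Prop :=
  forall i j : 'I_N, nat_of_ord j = i.+1 -> eq_mod2pi (x j) (x i + 2 * pi / N%:R).

Definition dinner N (x : 'I_N -> R) (v z : R -> R) : R :=
  2 * pi / N%:R * \sum_(j < N) v (x j) * z (x j).

Definition beta_seq L beta : Prop :=
  (forall l k, valid_pair L l k -> 0 <= beta l k) /\
  (forall i j : nat, (i <= j <= L.*2)%N ->
     beta (deg i) (ord i) <= beta (deg j) (ord j)).

(* RL restricts to the linear operator on [trig_poly L] that multiplies each
   Y l k by beta l k; its values elsewhere are irrelevant. *)
Definition is_reg_operator L beta (RL : (R -> R) -> (R -> R)) : Prop :=
  [/\ forall p, trig_poly L p -> trig_poly L (RL p),
      forall (a : R) p q, trig_poly L p -> trig_poly L q ->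
        RL (fun t => a * p t + q t) = (fun t => a * RL p t + RL q t)
    & forall l k, valid_pair L l k -> RL (Y l k) = (fun t => beta l k * Y l k t)].

(* The library norm on matrices is the sup norm. *)
Definition norm2 {n} (v : 'cV[R]_n) : R := Num.sqrt (\sum_(i < n) v i 0 ^+ 2).

Definition fvec N (x : 'I_N -> R) f : 'cV[R]_N := \col_(j < N) f (x j).

Definition Amx L N (x : 'I_N -> R) : 'M[R]_(N, L.*2.+1) :=
  \matrix_(j < N, i < L.*2.+1) Y (deg i) (ord i) (x j).

Definition Wmx N : 'M[R]_N := (2 * pi / N%:R)%:M.

(* W is diagonal with nonnegative entries, so its square root is entrywise. *)
Definition Whalf N : 'M[R]_N := map_mx Num.sqrt (Wmx N).

Lemma Whalf_sqr N : Whalf N *m Whalf N = Wmx N.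
Proof.
have -> : Whalf N = (Num.sqrt (2 * pi / N%:R))%:M.
  by apply/matrixP => i j; rewrite !mxE; case: eqP; rewrite ?mulr0n ?sqrtr0.
rewrite -scalar_mxM -expr2 sqr_sqrtr // divr_ge0 ?ler0n //.
by rewrite mulr_ge0 ?pi_ge0.
Qed.

Definition Bmx L beta : 'M[R]_(L.*2.+1) :=
  diag_mx (\row_(i < L.*2.+1) beta (deg i) (ord i)).

Definition Rmx L N beta (x : 'I_N -> R) : 'M[R]_(L.*2.+1, N) :=
  Bmx L beta *m (Amx L x)^T.

Definition coef_objective L N beta (x : 'I_N -> R) (lambda : R) f
    (alpha : 'cV[R]_(L.*2.+1)) : R :=
  norm2 (Whalf N *m (Amx L x *m alpha - fvec x f)) ^+ 2
  + lambda * norm2 (Whalf N *m (Rmx L beta x)^T *m alpha) ^+ 2.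

Definition poly_objective N (x : 'I_N -> R) (RL : (R -> R) -> (R -> R))
    (lambda : R) f p : R :=
  \sum_(j < N) 2 * pi / N%:R * (p (x j) - f (x j)) ^+ 2
  + lambda * \sum_(j < N) 2 * pi / N%:R * (RL p (x j)) ^+ 2.

Definition coef {L} (alpha : 'cV[R]_(L.*2.+1)) (l k : nat) : R :=
  alpha (inord (pos l k)) 0.

End Circle.

(* Main.v *)
Require Import Defs.
From mathcomp Require Import all_boot all_order all_algebra.
From mathcomp Require Import all_classical all_reals all_analysis.
From mathcomp Require Import zify ring lra.
Import Order.TTheory GRing.Theory Num.Theory.
Import numFieldNormedType.Exports.
Local Open Scope classical_set_scope.
Local Open Scope ring_scope.

(** The trapezoidal rule with N equidistant nodes integrates trigonometric
    polynomials of degree below N exactly, and a product of two basis functions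
    of degree at most L has degree at most 2 L < N.  Hence the functions
    [Y l k] are orthonormal for the discrete inner product ([Y_orthonormal]),
    that is, W^(1/2) A has orthonormal columns.

    For a design matrix with this property the Tikhonov functional decouples:
    the Gram matrix is the identity and the penalty is diagonal, so completing
    the square coordinate by coordinate ([tikhonov_complete_square]) writes it
    as a constant plus
      sum_i (1 + lambda b_i^2) (v_i - d_i / (1 + lambda b_i^2))^2,
    where d_i is the discrete inner product of f with the i-th basis function.
    All weights are positive, so the minimizer exists, is unique, and is read
    off ([minimizer_weighted_dist]).

    The polynomial problem is the same problem: [synth] parametrizes the
    trigonometric polynomials by their coefficients, the regularization
    operator acts on coefficients as the diagonal matrix B
    ([reg_operator_synth]), and the two objectives agree along [synth]
    ([poly_objective_synth]).  The uniqueness statement for polynomials thus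
    follows from the one for coefficients. *)

Set Implicit Arguments.
Unset Strict Implicit.
Unset Printing Implicit Defensive.

(** * Discrete orthonormality of the trigonometric basis *)

Section Quadrature.
Context {R : realType}.
Implicit Types (s t c : R) (n m : nat).

Lemma cosD2pi_int t (z : int) : cos (t + 2 * pi * z%:~R) = cos t.
Proof.
have cosn (u : R) n : cos (u + 2 * pi * n%:R) = cos u.
  by rewrite -(periodicn (@cosD2pi R) n u); congr cos; ring.
case: z => n; first exact: cosn.
by rewrite NegzE rmorphN mulrN -[LHS](cosn _ n.+1) subrK.
Qed.

Lemma eq_mod2pi_cos n c s t : eq_mod2pi s t ->
  cos (n%:R * s + c) = cos (n%:R * t + c).
Proof.
move=> [z ->]; rewrite -[RHS](cosD2pi_int _ (n%:Z * z)) intrM; congr cos.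
by rewrite -pmulrn; ring.
Qed.

(** Chaining the congruences between neighbouring nodes, starting from node 0. *)
Lemma equidistant_progression N (x : 'I_N -> R) : (0 < N)%N -> equidistant x ->
  exists x0, forall j : 'I_N, eq_mod2pi (x j) (x0 + j%:R * (2 * pi / N%:R)).
Proof.
case: N x => // N x _ hx; exists (x ord0).
suff H n (j : 'I_N.+1) : nat_of_ord j = n ->
    eq_mod2pi (x j) (x ord0 + n%:R * (2 * pi / N.+1%:R)).
  by move=> j; exact: H.
elim: n j => [|n IH] j hj.
  by exists 0; rewrite (_ : j = ord0) ?mul0r ?mulr0 ?addr0 //; exact: val_inj.
have hn : (n < N.+1)%N by rewrite -hj in IH *; have := ltn_ord j; lia.
have [z1 e1] := IH (Ordinal hn) erefl.
have [z2 ->] := hx (Ordinal hn) j hj.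
by exists (z1 + z2); rewrite e1 intrD -natr1; ring.
Qed.

(** Multiplying by 2 sin(h), with h half the angle between consecutive terms,
    makes the sum telescope; the two end terms differ by n full turns and
    cancel.  The factor sin(h) can be divided out since 0 < h < pi for
    0 < n < N.  The phase c is what lets one statement serve cosines and
    sines. *)
Lemma sum_cos_equidistant N (x : 'I_N -> R) n c : equidistant x ->
  (0 < n < N)%N -> \sum_(j < N) cos (n%:R * x j + c) = 0.
Proof.
move=> hx /andP[n0 nN].
have N0 : (0 < N)%N by exact: leq_trans nN.
have [x0 hx0] := equidistant_progression N0 hx.
have NR : N%:R != 0 :> R by rewrite pnatr_eq0; lia.
set h : R := pi * n%:R / N%:R.
have hs : sin h != 0.
  rewrite gt_eqF // sin_gt0_pi // /h divr_gt0 ?mulr_gt0 ?pi_gt0 ?ltr0n //=.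
  by rewrite ltr_pdivrMr ?ltr0n // ltr_pM2l ?pi_gt0 // ltr_nat.
(* half a step behind the j-th angle, so that g j.+1 is half a step ahead *)
pose g (j : nat) : R := sin (n%:R * x0 + c + j%:R * (h *+ 2) - h).
apply: (mulfI hs); apply: (@mulIf _ 2); rewrite // mulr0 mul0r.
have step (j : 'I_N) : sin h * cos (n%:R * x j + c) * 2 = g j.+1 - g j.
  rewrite (eq_mod2pi_cos _ _ (hx0 j)).
  set u := _ + c.
  have -> : g j.+1 = sin (u + h).
    by congr sin; rewrite /u /h -natr1 -mulr_natl; field.
  have -> : g j = sin (u - h).
    by congr sin; rewrite /u /h -mulr_natl; field.
  by rewrite !sinD sinN cosN; ring.
rewrite big_distrr big_distrl /= (eq_bigr _ (fun j _ => step j)).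
rewrite -(big_mkord predT (fun j => g j.+1 - g j)) telescope_sumr //.
rewrite /g mul0r addr0.
have -> : n%:R * x0 + c + N%:R * (h *+ 2) - h
        = n%:R * x0 + c - h + pi *+ 2 *+ n.
  by rewrite /h; field.
by rewrite (periodicn (@sinD2pi R)) subrr.
Qed.

(** Writing sin(u) = cos(u - pi / 2) gives all basis functions the form
    amplitude times shifted cosine, which reduces the products
    cos cos, cos sin and sin sin to a single product-to-sum formula. *)
Definition phase (k : nat) : R := if k == 1%N then 0 else pi / 2.
Definition amp (l : nat) : R :=
  if l == 0%N then (Num.sqrt (2 * pi))^-1 else (Num.sqrt pi)^-1.

Lemma Y_amp_phase L l k t : valid_pair L l k ->
  Y l k t = amp l * cos (l%:R * t + - phase k).
Proof.
rewrite /Y /amp /phase /valid_pair /gamma => -[_]; case: l => [|l] hk /=.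
  have -> : k = 1%N by lia.
  by rewrite eqxx mul0r add0r oppr0 cos0 mulr1 div1r.
by case: eqP => _; rewrite ?subr0 mulrC // -[_ - _]opprB cosN cosB cos_pihalf
  sin_pihalf mul0r add0r mul1r.
Qed.

(** A product of basis functions is a sum of two shifted cosines of frequencies
    l - l' and l + l' <= 2 L < N.  A nonzero frequency contributes nothing
    ([sum_cos_equidistant]), so only l = l' leaves a term, the constant
    cos(phase k' - phase k), which vanishes for k != k' since the phases then
    differ by pi / 2. *)
Lemma Y_orthonormal L N (x : 'I_N -> R) l k l' k' : equidistant x ->
  (2 * L < N)%N -> valid_pair L l k -> valid_pair L l' k' ->
  dinner x (Y l k) (Y l' k') = ((l == l') && (k == k'))%:R.
Proof.
move=> hx hLN hv hv'.
have NR : N%:R != 0 :> R by rewrite pnatr_eq0; lia.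
have pR : pi != 0 :> R by rewrite gt_eqF // pi_gt0.
have dE a b a' b' : valid_pair L a b -> valid_pair L a' b' -> (a' <= a)%N ->
  dinner x (Y a b) (Y a' b') = pi / N%:R * (amp a * amp a') *
    (\sum_(j < N) cos ((a - a')%:R * x j + (phase b' - phase b))
   + \sum_(j < N) cos ((a + a')%:R * x j - (phase b' + phase b))).
  move=> va va' le; rewrite /dinner -big_split /= !big_distrr /=.
  apply: eq_bigr => j _; rewrite (Y_amp_phase _ va) (Y_amp_phase _ va').
  set u := a%:R * x j + - phase b; set v := a'%:R * x j + - phase b'.
  have -> : (a - a')%:R * x j + (phase b' - phase b) = u - v.
    by rewrite /u /v natrB //; ring.
  have -> : (a + a')%:R * x j - (phase b' + phase b) = u + v.
    by rewrite /u /v natrD; ring.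
  by rewrite (cosB u v) (cosD u v); field.
have off a b a' b' : valid_pair L a b -> valid_pair L a' b' -> (a' < a)%N ->
    dinner x (Y a b) (Y a' b') = 0.
  move=> va va' lt; rewrite dE 1?ltnW // !sum_cos_equidistant ?addr0 ?mulr0 //.
    by case: va; case: va'; lia.
  by case: va; case: va'; lia.
have [lt|lt|e] := ltngtP l l'.
- apply: etrans _ (off _ _ _ _ hv' hv lt); congr (_ * _).
  by apply: eq_bigr => j _; rewrite mulrC.
- exact: off.
rewrite -e /= in hv' *.
rewrite dE // subnn (eq_bigr (fun=> cos (phase k' - phase k))); last first.
  by move=> j _; rewrite mul0r add0r.
rewrite sumr_const card_ord.
(* In degree 0 both frequencies vanish, whence the different normalization. *)
have [l0|l0] := posnP l.
  have k1 : k = 1%N by case: hv; rewrite /gamma l0; lia.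
  have k1' : k' = 1%N by case: hv'; rewrite /gamma l0; lia.
  rewrite (eq_bigr (fun=> 1)); last first.
    by move=> j _; rewrite l0 k1 k1' mul0r add0r /phase /= addr0 oppr0 cos0.
  rewrite sumr_const card_ord k1 k1' /phase /= subr0 cos0 /amp l0 /=.
  rewrite -invfM -expr2 sqr_sqrtr ?mulr_ge0 ?pi_ge0 //.
  by move: (pi : R) pR => P PR; field; rewrite NR PR.
rewrite sum_cos_equidistant //; last by case: hv; lia.
rewrite /amp gtn_eqF // -invfM -expr2 sqr_sqrtr ?pi_ge0 // addr0.
have -> : cos (phase k' - phase k) = (k == k')%:R.
  move: hv hv'; rewrite /valid_pair /gamma l0 => -[_ hk] [_ hk'].
  have [->|->] : k = 1%N \/ k = 2%N by lia.
    have [->|->] : k' = 1%N \/ k' = 2%N by lia.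
      by rewrite /phase subrr cos0.
    by rewrite /phase subr0 cos_pihalf.
  have [->|->] : k' = 1%N \/ k' = 2%N by lia.
    by rewrite /phase sub0r cosN cos_pihalf.
  by rewrite /phase subrr cos0.
by move: (pi : R) pR => P PR; field; rewrite NR PR.
Qed.

End Quadrature.

(** * Least squares with orthonormal columns and a diagonal penalty *)

Section Tikhonov.
Context {R : realType}.

Lemma minimizer_weighted_dist n (obj : 'cV[R]_n -> R) (w a : 'I_n -> R) K :
  (forall i, 0 < w i) ->
  (forall v, obj v = \sum_(i < n) w i * (v i 0 - a i) ^+ 2 + K) ->
  forall v, is_minimizer setT obj v <-> forall i, v i 0 = a i.
Proof.
move=> w0 objE v.
have sq0 (u : 'cV[R]_n) i : 0 <= w i * (u i 0 - a i) ^+ 2.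
  by rewrite mulr_ge0 ?sqr_ge0 // ltW.
split=> [[_ /(_ (\col_i a i) I)]|va].
  rewrite !objE lerD2r [leRHS]big1 => [le0 i|i _]; last first.
    by rewrite mxE subrr expr0n mulr0.
  have /eqP := le_anti (introT andP (conj le0 (sumr_ge0 _ (fun i _ => sq0 v i)))).
  rewrite psumr_eq0 // => /allP/(_ i (mem_index_enum i)) /=.
  by rewrite mulf_eq0 gt_eqF // sqrf_eq0 subr_eq0 => /eqP.
split=> // u _; rewrite !objE lerD2r [leLHS]big1 => [|i _].
  exact: sumr_ge0.
by rewrite va subrr expr0n mulr0.
Qed.

(** The orthonormality hypothesis turns w |A u|^2 into |u|^2, both for u = v and
    for the penalized vector, and w <A v, f> into <v, d>; what remains is a sum
    of independent one-variable quadratics. *)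
Lemma tikhonov_complete_square N n (A : 'M[R]_(N, n)) (w lambda : R)
    (b : 'I_n -> R) (f : 'I_N -> R) (v : 'cV[R]_n) :
  0 <= lambda ->
  (forall i k, w * \sum_(j < N) A j i * A j k = (i == k)%:R) ->
  let d i := w * \sum_(j < N) f j * A j i in
  w * \sum_(j < N) ((A *m v) j 0 - f j) ^+ 2
  + lambda * (w * \sum_(j < N) ((A *m (\col_i (b i * v i 0))) j 0) ^+ 2)
  = \sum_(i < n) (1 + lambda * b i ^+ 2) *
      (v i 0 - d i / (1 + lambda * b i ^+ 2)) ^+ 2
    + (w * \sum_(j < N) f j ^+ 2
       - \sum_(i < n) d i ^+ 2 / (1 + lambda * b i ^+ 2)).
Proof.
move=> l0 orth d.
have parseval (u : 'cV[R]_n) :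
    w * \sum_(j < N) ((A *m u) j 0) ^+ 2 = \sum_(i < n) u i 0 ^+ 2.
  rewrite (eq_bigr (fun j => \sum_i \sum_k u i 0 * u k 0 * (A j i * A j k))).
    rewrite exchange_big mulr_sumr /=; apply: eq_bigr => i _.
    rewrite exchange_big mulr_sumr (bigD1 i) //= [X in _ + X]big1 ?addr0 => [|k ki].
      by rewrite -mulr_sumr mulrCA orth eqxx mulr1.
    by rewrite -mulr_sumr mulrCA orth eq_sym (negbTE ki) mulr0.
  move=> j _; rewrite expr2 mxE mulr_suml; apply: eq_bigr => i _.
  by rewrite mulr_sumr; apply: eq_bigr => k _; ring.
have cross : w * \sum_(j < N) (A *m v) j 0 * f j = \sum_(i < n) v i 0 * d i.
  rewrite (eq_bigr (fun j => \sum_i v i 0 * (f j * A j i))).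
    rewrite exchange_big mulr_sumr /=; apply: eq_bigr => i _.
    by rewrite -mulr_sumr mulrCA.
  by move=> j _; rewrite mxE mulr_suml; apply: eq_bigr => i _; ring.
have -> : w * \sum_(j < N) ((A *m v) j 0 - f j) ^+ 2 =
    w * (\sum_(j < N) ((A *m v) j 0) ^+ 2)
    - 2 * (w * \sum_(j < N) (A *m v) j 0 * f j) + w * \sum_(j < N) f j ^+ 2.
  rewrite mulrCA -mulrBr -mulrDr; congr (_ * _).
  rewrite mulr_sumr -sumrB -big_split; apply: eq_bigr => j _ /=; ring.
rewrite !parseval cross addrAC addrA [RHS]addrAC; congr (_ + _).
rewrite !mulr_sumr -!sumrB -big_split /=.
apply: eq_bigr => i _; rewrite mxE.
have : 1 + lambda * b i ^+ 2 != 0.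
  by rewrite gt_eqF // ltr_pwDl // mulr_ge0 ?sqr_ge0.
by move=> ?; field.
Qed.

End Tikhonov.

(** * Coefficient vectors and trigonometric polynomials *)

Section Objectives.
Context {R : realType}.
Implicit Types (L N : nat) (beta : nat -> nat -> R).

(** Passing from L to L + 1 appends the pairs (L+1, 1) and (L+1, 2), which sit at
    positions 2 L + 1 and 2 L + 2. *)
Lemma sum_pairs (V : nmodType) L (F : nat -> nat -> V) :
  \sum_(0 <= l < L.+1) \sum_(1 <= k < (gamma l + 1).+1) F l k
  = \sum_(i < L.*2.+1) F (deg i) (ord i).
Proof.
elim: L => [|L IH]; first by rewrite !big_nat1 big_ord1.
rewrite big_nat_recr //= IH doubleS [RHS]big_ord_recr [X in _ = X + _]big_ord_recr.
rewrite /= -addrA (_ : gamma L.+1 + 1 = 2)%N // big_nat_recr // big_nat1.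
by rewrite /deg /ord /= odd_double /= uphalf_double doubleK.
Qed.

Definition synth L (v : 'cV[R]_(L.*2.+1)) (t : R) : R :=
  \sum_(i < L.*2.+1) v i 0 * Y (deg i) (ord i) t.

Lemma trig_comb_synth L (c : nat -> nat -> R) :
  trig_comb L c = synth (\col_(i < L.*2.+1) c (deg i) (ord i)).
Proof.
apply/funext => t; rewrite /trig_comb sum_pairs.
by apply: eq_bigr => i _; rewrite mxE.
Qed.

Lemma deg_ord_coef L (v : 'cV[R]_(L.*2.+1)) (i : 'I_(L.*2.+1)) :
  coef v (deg i) (ord i) = v i 0.
Proof. by rewrite /coef (deg_ordK (ltn_ord i)).2 inord_val. Qed.

Lemma trig_poly_synth L (v : 'cV[R]_(L.*2.+1)) : trig_poly L (synth v).
Proof.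
exists (coef v); rewrite trig_comb_synth; congr synth.
by apply/colP => i; rewrite mxE deg_ord_coef.
Qed.

Lemma coef_pairsP L (v : 'cV[R]_(L.*2.+1)) (a : nat -> nat -> R) :
  (forall l k, valid_pair L l k -> coef v l k = a l k) <->
  (forall i, v i 0 = a (deg i) (ord i)).
Proof.
split=> [va i|va l k lk].
  by rewrite -deg_ord_coef va //; exact: (deg_ordK (ltn_ord i)).1.
have [el ek] := posK lk.
by rewrite /coef va inordK ?pos_lt // el ek.
Qed.

Lemma synthP L (a : R) (u v : 'cV[R]_(L.*2.+1)) :
  synth (a *: u + v) = fun t => a * synth u t + synth v t.
Proof.
apply/funext => t; rewrite /synth mulr_sumr -big_split /=.
by apply: eq_bigr => i _; rewrite !mxE mulrDl mulrA.
Qed.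

Lemma synth_delta L (i : 'I_(L.*2.+1)) :
  synth (delta_mx i 0) = Y (R := R) (deg i) (ord i).
Proof.
apply/funext => t; rewrite /synth (bigD1 i) //= big1 => [|k ki].
  by rewrite mxE !eqxx mul1r addr0.
by rewrite mxE (negbTE ki) mul0r.
Qed.

(** Only a two-term linearity on trigonometric polynomials is known for [RL], so
    the expansion of v over the unit vectors is treated by induction on the
    list of indices; partial sums remain images of [synth], to which the
    linearity applies. *)
Lemma reg_operator_synth L beta (RL : (R -> R) -> (R -> R))
    (v : 'cV[R]_(L.*2.+1)) : is_reg_operator L beta RL ->
  RL (synth v) = synth (\col_i (beta (deg i) (ord i) * v i 0)).
Proof.
move=> [_ RLP RLY].
have col_delta (u : 'cV[R]_(L.*2.+1)) : u = \sum_i u i 0 *: delta_mx i 0.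
  by rewrite [LHS]matrix_sum_delta; apply: eq_bigr => i _; rewrite big_ord1.
rewrite [v in LHS]col_delta [\col_i _]col_delta.
elim: (index_enum _) => [|i r IH].
  (* RL 0 = 0, from linearity at 0 = -1 * 0 + 0 *)
  rewrite !big_nil.
  have := RLP (-1) _ _ (trig_poly_synth (0 : 'cV_(L.*2.+1))) (trig_poly_synth 0).
  have -> : synth (0 : 'cV[R]_(L.*2.+1)) = fun=> 0.
    by apply/funext => t; rewrite /synth big1 // => i _; rewrite mxE mul0r.
  have -> : (fun _ : R => -1 * 0 + 0) = (fun=> 0 : R).
    by apply/funext => t; rewrite mulr0 addr0.
  move=> ->; apply/funext => t; by rewrite mulN1r addNr.
rewrite !big_cons !synthP RLP; try exact: trig_poly_synth.
rewrite IH !synth_delta RLY; last exact: (deg_ordK (ltn_ord i)).1.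
by apply/funext => t; rewrite mxE; ring.
Qed.

Lemma Amx_synth L N (x : 'I_N -> R) (v : 'cV[R]_(L.*2.+1)) (j : 'I_N) :
  (Amx L x *m v) j 0 = synth v (x j).
Proof. by rewrite mxE; apply: eq_bigr => i _; rewrite mxE mulrC. Qed.

Lemma norm2_Whalf N (u : 'cV[R]_N) :
  norm2 (Whalf N *m u) ^+ 2 = 2 * pi / N%:R * \sum_(j < N) u j 0 ^+ 2.
Proof.
have w0 : 0 <= 2 * pi / N%:R :> R by rewrite divr_ge0 ?mulr_ge0 ?pi_ge0.
rewrite /norm2 sqr_sqrtr ?sumr_ge0 // => [|j _]; last exact: sqr_ge0.
have -> : Whalf N = (Num.sqrt (2 * pi / N%:R))%:M :> 'M[R]_N.
  by apply/matrixP => i j; rewrite !mxE; case: eqP; rewrite ?mulr0n ?sqrtr0.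
rewrite mulr_sumr; apply: eq_bigr => j _.
by rewrite mul_scalar_mx mxE exprMn sqr_sqrtr.
Qed.

Lemma coef_objectiveE L N beta (x : 'I_N -> R) lambda f
    (v : 'cV[R]_(L.*2.+1)) :
  coef_objective beta x lambda f v =
  2 * pi / N%:R * \sum_(j < N) ((Amx L x *m v) j 0 - f (x j)) ^+ 2
  + lambda * (2 * pi / N%:R * \sum_(j < N)
      ((Amx L x *m (\col_i (beta (deg i) (ord i) * v i 0))) j 0) ^+ 2).
Proof.
rewrite /coef_objective -mulmxA !norm2_Whalf; congr (_ * _ + _ * (_ * _)).
  by apply: eq_bigr => j _; rewrite !mxE.
apply: eq_bigr => j _; rewrite /Rmx /Bmx trmx_mul trmxK tr_diag_mx -mulmxA.
rewrite mul_diag_mx; congr ((_ *m _) j 0 ^+ 2).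
by apply/colP => i; rewrite !mxE.
Qed.

Lemma poly_objective_synth L N beta (x : 'I_N -> R) RL lambda f
    (v : 'cV[R]_(L.*2.+1)) : is_reg_operator L beta RL ->
  poly_objective x RL lambda f (synth v) = coef_objective beta x lambda f v.
Proof.
move=> hRL; rewrite coef_objectiveE /poly_objective (reg_operator_synth _ hRL).
rewrite -!mulr_sumr; congr (_ * _ + _ * (_ * _)).
  by apply: eq_bigr => j _; rewrite Amx_synth.
by apply: eq_bigr => j _; rewrite Amx_synth.
Qed.

End Objectives.

Theorem theorem3p2 (R : realType) (L N : nat) (x : 'I_N -> R)
    (beta : nat -> nat -> R) (RL : (R -> R) -> (R -> R))
    (lambda : R) (f : R -> R)
    (hN : odd N) (hLN : (2 * L + 1 <= N)%N)
    (hx : equidistant x)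
    (hbeta : beta_seq L beta)
    (hRL : is_reg_operator L beta RL)
    (hlambda : 0 < lambda)
    (hf : circle_continuous f) :
  (forall alpha : 'cV[R]_(L.*2.+1),
     is_minimizer setT (coef_objective beta x lambda f) alpha <->
     (forall l k : nat, valid_pair L l k ->
        coef alpha l k = dinner x f (Y l k) / (1 + lambda * beta l k ^+ 2))) /\
  (forall p : R -> R,
     is_minimizer (trig_poly L) (poly_objective x RL lambda f) p <->
     p = (fun t : R =>
            \sum_(0 <= l < L.+1) \sum_(1 <= k < (gamma l + 1).+1)
               dinner x f (Y l k) / (1 + lambda * beta l k ^+ 2) * Y l k t)).
Proof.
set a := fun l k => dinner x f (Y l k) / (1 + lambda * beta l k ^+ 2).
have coefP (v : 'cV[R]_(L.*2.+1)) :
    is_minimizer setT (coef_objective beta x lambda f) v <->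
    forall i, v i 0 = a (deg i) (ord i).
  apply: minimizer_weighted_dist => [i|u]; last first.
    rewrite coef_objectiveE (tikhonov_complete_square _ _ _ (ltW hlambda)).
      congr (_ + _); apply: eq_bigr => i _.
      congr (_ * (_ - _ / _) ^+ 2); congr (_ * _).
      by apply: eq_bigr => j _; rewrite mxE.
    move=> i k.
    have [vi pi_] := deg_ordK (ltn_ord i); have [vk pk] := deg_ordK (ltn_ord k).
    transitivity (dinner x (Y (deg i) (ord i)) (Y (deg k) (ord k))).
      by congr (_ * _); apply: eq_bigr => j _; rewrite !mxE.
    rewrite (Y_orthonormal hx _ vi vk); last lia.
    congr (nat_of_bool _)%:R; apply/andP/eqP => [[/eqP el /eqP ek]|->] //.
    by apply: val_inj; rewrite /= -pi_ -pk el ek.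
  by rewrite ltr_pwDl // mulr_ge0 ?sqr_ge0 // ltW.
split=> [v|p]; first by apply: iff_trans (coefP v) _; apply: iff_sym (coef_pairsP _ _).
rewrite -[fun t => _]/(trig_comb L a) trig_comb_synth.
have polyE := poly_objective_synth x lambda f _ hRL.
split=> [[[c ->] pmin]|->].
  move: pmin; rewrite trig_comb_synth; set v := (\col_i _) => pmin.
  congr synth; apply/colP => i; rewrite mxE; move: i; apply/coefP.
  split=> // u _; rewrite -!polyE; apply: pmin; exact: trig_poly_synth.
have [_ vmin] : is_minimizer setT (coef_objective beta x lambda f)
    (\col_(i < L.*2.+1) a (deg i) (ord i)) by apply/coefP => i; rewrite mxE.
split; first exact: trig_poly_synth.
by move=> _ [c ->]; rewrite trig_comb_synth !polyE; exact: vmin.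
Qed.
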